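(* Let $\mathcal{H}$ be a real Hilbert space, let $\mathcal{Z} \subseteq \mathcal{H}$ be a closed convex set with $0 \in \mathcal{Z}$, and let $T \in (0,\infty)$. Assume that $u \in BV([0,T];\mathcal{H})$ is right continuous on $[0,T]$ (i.e. $u(t+)=u(t)$ for all $t \in [0,T]$) and that $z_0 \in \mathcal{Z}$. Let $y \in BV([0,T];\mathcal{H})$ be the unique function satisfying (1) $u(t) - y(t) \in \mathcal{Z}$ for all $t \in [0,T]$; (2) $\displaystyle\int_{\mathrm{Cont}(u)} \langle z(t) - u(t) + y(t), \,d\mathrm{D}y(t)\rangle \le 0$ for every $z \in L^\infty([0,T];\mathcal{H})$ with $z([0,T]) \subseteq \mathcal{Z}$; (3) $u(t) - y(t) = \mathrm{Proj}_{\mathcal{Z}}(u(t) - y(t-))$ for all $t \in \mathrm{Discont}(u) \setminus \{0\}$; (4) $u(t+) - y(t+) = \mathrm{Proj}_{\mathcal{Z}}(u(t+) - y(t))$ for all $t \in \mathrm{Discont}(u)$; (5) $u(0) - y(0) = z_0$. Then $y$ is right continuous and (a) $u(t) - y(t) \in \mathcal{Z}$ for all $t \in [0,T]$; (b) $\displaystyle\int_{[0,T]} \langle z(t) - u(t) + y(t), \,d\mathrm{D}y(t)\rangle \le 0$ for every $z \in L^\infty([0,T];\mathcal{H})$ with $z([0,T]) \subseteq \mathcal{Z}$; (c) $u(0) - y(0) = z_0$.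
   Context: $\mathcal{H}$ has inner product $\langle\cdot,\cdot\rangle$ and norm $\|\cdot\|$. For $f:[0,T]\to\mathcal{H}$ (pointwise defined; functions are not identified when equal a.e.) the pointwise variation is $V(f,[0,T]) = \sup \sum_{j=1}^m \|f(t_j)-f(t_{j-1})\|$ over all $m\ge 1$ and $t_0<\dots<t_m$ in $[0,T]$; $BV([0,T];\mathcal{H})$ is the set of $f$ with $V(f,[0,T])<\infty$. Such $f$ has one-sided limits $f(t-)$, $f(t+)$ at every $t\in[0,T]$, with the convention $f(0-):=f(0)$ and $f(T+):=f(T)$. $\mathrm{Cont}(f)$ is the set of continuity points of $f$ in $[0,T]$ and $\mathrm{Discont}(f)=[0,T]\setminus\mathrm{Cont}(f)$. $\mathrm{Proj}_{\mathcal{Z}}(x)$ is the unique point of $\mathcal{Z}$ nearest to $x$. For $f\in BV([0,T];\mathcal{H})$, $\mathrm{D}f$ denotes its differential (Lebesgue-Stieltjes) measure: the unique $\mathcal{H}$-valued measure of bounded variation on $[0,T]$ with $\mathrm{D}f((c,d))=f(d-)-f(c+)$, $\mathrm{D}f([c,d])=f(d+)-f(c-)$, $\mathrm{D}f([c,d))=f(d-)-f(c-)$, $\mathrm{D}f((c,d])=f(d+)-f(c+)$ for $c<d$ in $[0,T]$ (so $\mathrm{D}f(\{t\})=f(t+)-f(t-)$). For an $\mathcal{H}$-valued measure $\mu$ with bounded variation and total variation measure $|\mu|$, the integral $\int\langle g,d\mu\rangle\in\mathbb{R}$ is defined for simple functions $g=\sum_j \mathbf{1}_{A_j} g_j$ ($A_j$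 disjoint measurable, $g_j\in\mathcal{H}$) by $\sum_j\langle g_j,\mu(A_j)\rangle$ and extended by continuity to $g\in L^1(|\mu|;\mathcal{H})$; $\int_B\langle g,d\mu\rangle := \int\langle\mathbf{1}_B g,d\mu\rangle$. $L^\infty([0,T];\mathcal{H})$ denotes the bounded strongly Borel measurable functions $z:[0,T]\to\mathcal{H}$ (everywhere defined). Existence and uniqueness of $y\in BV([0,T];\mathcal{H})$ satisfying (1)-(5) holds for every $u\in BV([0,T];\mathcal{H})$ and $z_0\in\mathcal{Z}$ (another theorem of the paper).
   Formalization: Conditions (1)–(5) do not determine y uniquely (for u=0, changing y at one interior point within u−Z gives another, non-right-continuous solution), so y is assumed to be a solution that is either literally unique or satisfies Cont(u) ⊆ Cont(y). *)

(* Defs.v *)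
From HB Require Import structures.
From mathcomp Require Import all_boot all_order all_algebra.
From mathcomp Require Import sesquilinear.
From mathcomp Require Import all_classical all_reals all_analysis.

Set Implicit Arguments.
Unset Strict Implicit.
Unset Printing Implicit Defensive.

Import Order.TTheory GRing.Theory Num.Theory.
Import numFieldNormedType.Exports.

Local Open Scope classical_set_scope.
Local Open Scope ring_scope.

(* Functions [0, T] -> H are represented by functions R -> H of which only the
   values on [0, T] matter. *)

Section pointwise_bv.
Context {R : realType} {H : normedModType R}.
Implicit Types (T t : R) (f : R -> H).

Definition pvariation T f : \bar R :=
  ereal_sup [set s : \bar R | exists (m : nat) (p : nat -> R),
    [/\ (0 < m)%N,
        forall j, (j <= m)%N -> p j \in `[0, T],
        forall j, (j < m)%N -> p j < p j.+1 &
        s = (\sum_(j < m) `|f (p j.+1) - f (p j)|)%:E]].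

Definition BV T f := (pvariation T f < +oo)%E.

Definition limm f t : H := if t == 0 then f 0 else lim (f x @[x --> t^'-]).

Definition limp T f t : H := if t == T then f T else lim (f x @[x --> t^'+]).

Definition rcontinuous T f :=
  forall t : R, t \in `[0, T] -> limp T f t = f t.

Definition Cont T f : set R :=
  [set t : R | t \in `[0, T] /\ f x @[x --> within `[0, T] (nbhs t)] --> f t].

Definition Discont T f : set R := `[0, T] `\` Cont T f.

End pointwise_bv.

Definition Proj {R : realType} {H : normedModType R} (Z : set H) (x : H) : H :=
  xget 0 [set p | Z p /\ forall q, Z q -> `|x - p| <= `|x - q|].

(* H-valued measures on the Borel subsets of a Borel set D of the line; such a
   measure is a function set R -> H of which only the values on the Borel
   subsets of D matter. *)
Section vector_measure.
Context {R : realType} {H : normedModType R}.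
Implicit Types (D A : set R) (mu : set R -> H) (g : R -> H).

Definition vector_measure D mu :=
  forall F : nat -> set R,
    (forall n, measurable (F n)) -> (forall n, F n `<=` D) ->
    trivIset setT F ->
    (\sum_(k < n) mu (F k)) @[n --> \oo] --> mu (\bigcup_n F n).

Definition vtotal_variation D mu A : \bar R :=
  ereal_sup [set s : \bar R | exists (n : nat) (F : nat -> set R),
    [/\ forall k, measurable (F k),
        forall k, F k `<=` D `&` A,
        trivIset setT F &
        s = (\sum_(k < n) `|mu (F k)|)%:E]].

Definition vsimple D g :=
  finite_set (g @` D) /\ forall h, measurable (D `&` g @^-1` [set h]).

Definition strongly_measurable D g :=
  exists gn : nat -> R -> H, (forall n, vsimple D (gn n)) /\
    forall x, D x -> gn n x @[n --> \oo] --> g x.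

Definition Linfty D g :=
  strongly_measurable D g /\ exists M : R, forall x, D x -> `|g x| <= M.

End vector_measure.

Section vector_integral.
Context {R : realType} {H : normedModType R} (ip : {dot H for idfun}).
Implicit Types (D B : set R) (mu : set R -> H) (g : R -> H).

Definition vsintegral D mu g : R :=
  \sum_(h \in g @` D) ip h (mu (D `&` g @^-1` [set h])).

(* The extension by continuity from simple functions to L^1(|mu|; H): the value
   of the integral at g is the limit of the integrals of simple functions
   converging to g in L^1(|mu|; H). *)
Definition is_vintegral D mu g (v : R) :=
  strongly_measurable D g /\
  exists gn : nat -> R -> H,
    [/\ forall n, vsimple D (gn n),
        (\int[vtotal_variation D mu]_(x in D) `|gn n x - g x|%:E)%E
          @[n --> \oo] --> (0 : \bar R) &
        vsintegral D mu (gn n) @[n --> \oo] --> v].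

Definition vintegral D mu g : R := xget 0 (is_vintegral D mu g).

Definition vintegral_on D mu B g : R := vintegral D mu (fun x => \1_B x *: g x).

End vector_integral.

Section differential_measure.
Context {R : realType} {H : normedModType R}.
Implicit Types (T : R) (f : R -> H) (mu : set R -> H).

Definition is_differential_measure T f mu :=
  [/\ vector_measure `[0, T] mu,
      ((vtotal_variation `[0, T] mu `[0, T])%R < +oo)%E &
      forall c d : R, c \in `[0, T] -> d \in `[0, T] -> c < d ->
        [/\ mu `]c, d[%classic = limm f d - limp T f c,
            mu `[c, d]%classic = limp T f d - limm f c,
            mu `[c, d[%classic = limm f d - limm f c &
            mu `]c, d]%classic = limp T f d - limp T f c]].

Definition differential_measure T f : set R -> H :=
  xget (fun _ => 0) (is_differential_measure T f).

End differential_measure.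

Section play.
Context {R : realType} {H : normedModType R} (ip : {dot H for idfun}).

Definition play_solution (Z : set H) (T : R) (u : R -> H) (z0 : H)
    (y : R -> H) :=
  BV T y /\
  [/\ forall t : R, t \in `[0, T] -> Z (u t - y t),
      forall z : R -> H, Linfty `[0, T] z -> z @` `[0, T] `<=` Z ->
        vintegral_on ip `[0, T] (differential_measure T y) (Cont T u)
          (fun t => z t - u t + y t) <= 0,
      forall t : R, t \in `[0, T] -> Discont T u t -> t != 0 ->
        u t - y t = Proj Z (u t - limm y t),
      forall t : R, Discont T u t ->
        limp T u t - limp T y t = Proj Z (limp T u t - y t) &
      u 0 - y 0 = z0].

End play.

(* Main.v *)
Require Import Defs.
From HB Require Import structures.
From mathcomp Require Import all_boot all_order all_algebra.
From mathcomp Require Import ring lra finmap sesquilinear.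
From mathcomp Require Import all_classical all_reals all_analysis.
From mathcomp Require Import measurable_realfun.

Set Implicit Arguments.
Unset Strict Implicit.
Unset Printing Implicit Defensive.

Import Order.TTheory GRing.Theory Num.Theory.
Import numFieldNormedType.Exports.

Local Open Scope classical_set_scope.
Local Open Scope ring_scope.

(** The function [y] can only jump where [u] does, and there the projection
    conditions say what the inequality asks of the atoms of [Dy].

    Right continuity.  At a discontinuity [t] of [u] the second jump condition
    reads [u t - limp T y t = Proj Z (u t - y t)] because [u] is right continuous,
    and [u t - y t] is in [Z], hence its own projection ([Proj_id]); so
    [limp T y t = y t].  At a continuity point of [u] the function [y] is
    continuous, by assumption or as a consequence of uniqueness: [u] and [y]
    have countably many discontinuities ([countable_Discont]), so they have a common
    continuity point [c] in [(0, T)]; changing [y] at [c] alone, to any value in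
    [u c - Z], preserves all the conditions ([play_solution_update]), so uniqueness
    forces [Z] to be the single point [0], and then [y = u] on [[0, T]]
    ([play_unique_eq]).

    Inequality.  The interval is the disjoint union of [Cont T u] and the countable
    set [Discont T u].  On the first set the integral is nonpositive by assumption.
    The second contributes the sum over its points [t] of
    [ip (z t - u t + y t) (Dy [set t])], and [Dy [set t] = y t - limm y t] by right
    continuity; with [x := u t - limm y t] and [p := u t - y t = Proj Z x] this is
    [ip (z t - p) (x - p)], nonpositive by the obtuse angle property of the
    projection on a convex set ([Proj_obtuse]).

    Splitting the integral requires the vector integral to be well behaved: the
    total variation is a measure
    ([vtotal_variation_semi_sigma_additive]), the integral of a simple function is
    bounded by the integral of its norm ([vsintegral_le]), so the integral is
    uniquely determined and exists along every sequence of simple functions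
    converging in mean ([is_vintegral_unique], [is_vintegral_exists]), and a
    countable set is seen through its atoms only ([is_vintegral_cocountable]).

    The differential measure enters through its countable additivity and its values
    on singletons, in terms of [limp] and [limm]
    ([differential_measureP]). *)

(** * Projection on a closed convex set of a Hilbert space *)

Section real_hilbert_space.
Context {R : realType} {H : normedModType R} (ip : {dot H for idfun}).
Hypothesis hip : forall x : H, `|x| ^+ 2 = ip x x.

Lemma ipC x y : ip x y = ip y x.
Proof. by rewrite (hermC ip) expr0 mul1r. Qed.

Lemma ipZl a x y : ip (a *: x) y = a * ip x y.
Proof. exact: linearZl_LR. Qed.

Lemma ipZr a x y : ip x (a *: y) = a * ip x y.
Proof. by rewrite ipC ipZl ipC. Qed.

Lemma normrD_ip x y : `|x + y| ^+ 2 = `|x| ^+ 2 + ip x y *+ 2 + `|y| ^+ 2.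
Proof. by rewrite !hip linearDl/= !linearDr/= (ipC y x); ring. Qed.

Lemma ip_cauchy_schwarz x y : `|ip x y| <= `|x| * `|y|.
Proof.
have [->|y0] := eqVneq y 0; first by rewrite linear0r !normr0 mulr0.
have n0 : 0 < `|y| ^+ 2 by rewrite exprn_gt0// normr_gt0.
have : 0 <= `|y| ^+ 2 * ((`|x| * `|y|) ^+ 2 - `|ip x y| ^+ 2).
  apply: le_trans (sqr_ge0 `|(`|y| ^+ 2) *: x + (- ip x y) *: y|) _.
  rewrite normrD_ip !normrZ ipZl ipZr normrN normr_id -expr2.
  rewrite !exprMn real_normK ?num_real// le_eqVlt; apply/orP; left.
  by apply/eqP; ring.
rewrite pmulr_rge0// subr_ge0 ler_sqr ?nnegrE// mulr_ge0//.
Qed.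

Lemma convex_segment (Z : set H) p q a : convex_set Z -> Z p -> Z q ->
  0 <= a <= 1 -> Z (p + a *: (q - p)).
Proof.
move=> cZ Zp Zq /andP[a0 a1].
have := cZ q p (Itv01 a0 a1); rewrite !inE => /(_ Zq Zp).
rewrite -[X in Z X -> _]/(a *: q + (1 - a) *: p).
by rewrite scalerBr scalerBl scale1r addrCA.
Qed.

(** If the angle at [p] were acute, a short step from [p] towards [q] would stay
    in [Z] and come closer to [x]. *)
Lemma minimizer_obtuse (Z : set H) x p q : convex_set Z ->
  Z p -> (forall q, Z q -> `|x - p| <= `|x - q|) -> Z q ->
  ip (x - p) (q - p) <= 0.
Proof.
move=> cZ Zp pmin Zq.
have step a : 0 < a <= 1 -> ip (x - p) (q - p) *+ 2 <= a * `|q - p| ^+ 2.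
  move=> /andP[a0 a1].
  have Zr : Z (p + a *: (q - p)) by apply: convex_segment => //; rewrite ltW.
  have := pmin _ Zr; rewrite -ler_sqr ?nnegrE// opprD addrA -scaleNr.
  rewrite (normrD_ip (x - p)) normrZ ipZr exprMn real_normK ?num_real// sqrrN.
  by move=> h; rewrite -(ler_pM2l a0); nra.
rewrite leNgt; apply/negP => i0.
have N0 : 0 <= `|q - p| ^+ 2 by exact: sqr_ge0.
set i := ip _ _ in step i0; set N := _ ^+ 2 in step N0.
(* a step [a <= 1] with [a * N < 2 * i], defined even when [N = 0] *)
have D0 : 0 < i + N by lra.
have aD : i / (i + N) * (i + N) = i by rewrite divfK// gt_eqF.
set a := i / (i + N) in aD.
have a0 : 0 < a by rewrite divr_gt0.
have a1 : a <= 1 by rewrite ler_pdivrMr// mul1r; lra.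
have : 0 < a <= 1 by rewrite a0.
by move=> /step h; nra.
Qed.

Lemma parallelogram (x y : H) :
  `|x + y| ^+ 2 + `|x - y| ^+ 2 = `|x| ^+ 2 *+ 2 + `|y| ^+ 2 *+ 2.
Proof. by rewrite !normrD_ip normrN -scaleN1r ipZr; ring. Qed.

(** The midpoint of [q] and [r] lies in the convex set [Z], hence at distance at
    least [d] from [x]; the parallelogram law turns this into a bound on [q - r]. *)
Lemma minimizers_close (Z : set H) (x q r : H) d e : convex_set Z ->
  (forall q, Z q -> d <= `|x - q|) -> 0 <= d -> Z q -> Z r ->
  `|x - q| <= d + e -> `|x - r| <= d + e ->
  `|q - r| ^+ 2 <= (8 * d + 4 * e) * e.
Proof.
move=> cZ dmin d0 Zq Zr xq xr.
have h01 : 0 <= (2^-1 : R) <= 1 by rewrite invr_ge0 ler0n/= invf_le1// ler1n.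
have := dmin _ (convex_segment cZ Zq Zr h01).
set c := q + _ => dc.
have pl := parallelogram (x - q) (x - r).
have e1 : (x - q) + (x - r) = 2 *: (x - c).
  rewrite /c scalerBr scalerDr scalerA divff// scale1r !scaler_nat !mulr2n.
  by rewrite (addrACA q) subrr addr0 opprD addrACA.
have e2 : (x - q) - (x - r) = r - q by rewrite opprB addrC addrA subrK.
rewrite e1 e2 normrZ normr_nat (distrC r q) in pl.
have n1 := normr_ge0 (x - q); have n2 := normr_ge0 (x - r).
move: dc xq xr pl n1 n2.
move: `|x - c| `|x - q| `|x - r| `|q - r| => C A B N dC Aq Br pl A0 B0.
have A2 : A ^+ 2 <= (d + e) ^+ 2 by rewrite ler_pXn2r// nnegrE; lra.
have B2 : B ^+ 2 <= (d + e) ^+ 2 by rewrite ler_pXn2r// nnegrE; lra.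
have C2 : d ^+ 2 <= C ^+ 2 by rewrite ler_pXn2r// nnegrE; lra.
nra.
Qed.

End real_hilbert_space.

(** A minimizing sequence is Cauchy by [minimizers_close], so it converges, and its
    limit stays in the closed set [Z]. *)
Lemma exists_minimizer (R : realType) (H : completeNormedModType R)
    (ip : {dot H for idfun}) (hip : forall x : H, `|x| ^+ 2 = ip x x)
    (Z : set H) x : closed Z -> convex_set Z -> Z !=set0 ->
  exists p, Z p /\ forall q, Z q -> `|x - p| <= `|x - q|.
Proof.
move=> clZ cZ [p0 Zp0].
pose E : set R := [set `|x - q| | q in Z].
have lbE : lbound E 0 by move=> _ [q _ <-].
have hE : has_inf E by split; [exists `|x - p0|, p0 | exists 0].
pose d := inf E.
have d0 : 0 <= d by apply: lb_le_inf => //; case: hE.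
have dmin q : Z q -> d <= `|x - q|.
  by move=> Zq; apply: ge_inf; [exists 0 | exists q].
have /choice[u uP] : forall n : nat, exists q, Z q /\ `|x - q| <= d + n.+1%:R^-1.
  move=> n; have [|_ [q Zq <-] h] := @inf_adherent _ E n.+1%:R^-1 _ hE.
    by rewrite invr_gt0.
  by exists q; split => //; exact: ltW.
have cu : cvgn u.
  apply/cauchy_cvgP/cauchy_exP => eps eps0.
  (* since [b <= 1], the bound [(8 * d + 4 * b) * b] on squared distances is less
     than [(8 * d + 5) * b <= eps ^+ 2] *)
  pose b := Num.min 1 (eps ^+ 2 / (8 * d + 5)).
  have D0 : 0 < 8 * d + 5 by lra.
  have b0 : 0 < b by rewrite lt_min ltr01/= divr_gt0// exprn_gt0.
  have [N _ NP] := near_infty_natSinv_lt (PosNum b0).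
  have close n : (N <= n)%N -> `|x - u n| <= d + b.
    by move=> /NP /= /ltW h; apply: le_trans (uP n).2 _; rewrite lerD2l.
  exists (u N), N => //= n Nn; rewrite -ball_normE /ball_/=.
  rewrite -ltr_sqr ?nnegrE ?(ltW eps0)//.
  apply: le_lt_trans (minimizers_close hip cZ dmin d0 (uP N).1 (uP n).1 _ _) _.
  - exact: close.
  - exact: close.
  have b1 : b <= 1 by rewrite ge_min lexx.
  have : b <= eps ^+ 2 / (8 * d + 5) by rewrite ge_min lexx orbT.
  rewrite ler_pdivlMr// => h; nra.
have [p cul] : exists p : H, u @ \oo --> p by apply/cvg_ex.
exists p; split.
  by apply: (@closed_cvg _ _ \oo _ u Z clZ _ p cul); near=> n; have [] := uP n.
move=> q Zq; apply: le_trans (dmin q Zq).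
apply: (@ler_cvg_to _ \oo _ _ (fun n => `|x - u n|) (fun n => d + n.+1%:R^-1)).
- by apply: cvg_norm; apply: cvgB => //; exact: cvg_cst.
- by rewrite -[X in _ --> X]addr0; apply: cvgD; [exact: cvg_cst|exact: cvg_harmonic].
- by near=> n; have [] := uP n.
Unshelve. all: by end_near. Qed.

Lemma Proj_obtuse (R : realType) (H : completeNormedModType R)
    (ip : {dot H for idfun}) (hip : forall x : H, `|x| ^+ 2 = ip x x)
    (Z : set H) x q : closed Z -> convex_set Z -> Z q ->
  ip (x - Proj Z x) (q - Proj Z x) <= 0.
Proof.
move=> clZ cZ Zq.
have Z0 : Z !=set0 by exists q.
have [ZP Pmin] := xgetPex 0 (exists_minimizer hip x clZ cZ Z0).
exact: (minimizer_obtuse hip cZ).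
Qed.

Lemma Proj_id (R : realType) (H : normedModType R) (Z : set H) x :
  Z x -> Proj Z x = x.
Proof.
move=> Zx; apply: xget_unique.
  by split => // q _; rewrite subrr normr0.
move=> p [_ /(_ _ Zx)]; rewrite subrr normr0 normr_le0 subr_eq0.
by move=> /eqP.
Qed.

(** * The total variation of a vector measure *)

Section vector_measure_theory.
Context {R : realType} {H : normedModType R}.
Variables (D : set R) (mu : set R -> H).
Hypothesis muD : vector_measure D mu.

Lemma vector_measure0 : mu set0 = 0.
Proof.
have /muD muS : forall n : nat, measurable (@set0 R) by [].
have {muS} := muS (fun _ => @sub0set _ _) (@trivIset_set0 _ _ _).
rewrite bigcup0// => cmu.
have cmuS : (\sum_(k < n.+1) mu set0) @[n --> \oo] --> mu set0.
  by rewrite (cvg_shiftS (fun n => \sum_(k < n) mu set0)).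
have := cvgB cmuS cmu.
rewrite subrr => /(_ _)-h; rewrite -(cvg_lim (@norm_hausdorff _ H) h).
apply/esym/cvg_lim; first exact: norm_hausdorff.
apply: cvg_near_cst; near=> n.
change (\sum_(k < n.+1) mu set0 - \sum_(k < n) mu set0 = mu set0).
rewrite big_ord_recr/= addrAC subrr add0r.
Unshelve. all: by end_near.
Qed.

Lemma vector_measureU A B : measurable A -> measurable B ->
  A `<=` D -> B `<=` D -> A `&` B = set0 -> mu (A `|` B) = mu A + mu B.
Proof.
move=> mA mB AD BD AB.
have c : (\sum_(k < n) mu (bigcup2 A B k)) @[n --> \oo] --> mu (A `|` B).
  rewrite -bigcup2E; apply: muD => [n|n|].
  - by case: n => [|[|n]] /=.
  - by case: n => [|[|n]] /=.
  - by rewrite -trivIset_bigcup2.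
rewrite -(cvg_lim (@norm_hausdorff _ H) c); apply: cvg_lim; first exact: norm_hausdorff.
rewrite -(cvg_shiftn 2).
apply: cvg_near_cst; near=> n.
rewrite /= addn2 !big_ord_recl/= big1 ?addr0// => i _.
exact: vector_measure0.
Unshelve. all: by end_near. Qed.

Lemma vector_measure_bigU (K : choiceType) (r : seq K) (F : K -> set R) :
  uniq r -> (forall i, measurable (F i)) -> (forall i, F i `<=` D) ->
  trivIset setT F ->
  mu (\big[setU/set0]_(i <- r) F i) = \sum_(i <- r) mu (F i).
Proof.
move=> + mF FD tF; elim: r => [|i r ih] /=.
  by rewrite !big_nil vector_measure0.
move=> /andP[ir ur]; rewrite !big_cons vector_measureU ?ih//.
- by apply: bigsetU_measurable.
- by rewrite -bigcup_seq; exact: bigcup_sub.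
- rewrite -bigcup_seq setI_bigcupr bigcup0// => j /= jr.
  apply: contrapT => /eqP/set0P/tF => /(_ I I) ij.
  by move: ir; rewrite ij jr.
Qed.

Local Notation tv := (vtotal_variation D mu).

Lemma vtotal_variation_ge (A B : set R) :
  measurable B -> B `<=` D `&` A -> (`|mu B|%:E <= tv A)%E.
Proof.
move=> mB BDA; apply: ereal_sup_ubound.
exists 1%N, (bigcup2 B set0); split.
- by case=> [|[|n]] /=.
- by case=> [|[|n]] /=.
- by rewrite -trivIset_bigcup2 setI0.
- by rewrite big_ord_recl big_ord0 addr0.
Qed.

Lemma vtotal_variation_ge0 A : (0 <= tv A)%E.
Proof.
by apply: le_trans (vtotal_variation_ge measurable0 (@sub0set _ _)); rewrite lee_fin.
Qed.

Lemma vtotal_variation0 : tv set0 = 0%E.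
Proof.
apply/eqP; rewrite eq_le vtotal_variation_ge0 andbT.
apply: ge_ereal_sup => _ [n [F [mF FD tF ->]]].
rewrite big1// => i _.
have -> : F i = set0 by apply/seteqP; split => // x /FD [].
by rewrite vector_measure0 normr0.
Qed.

Lemma le_vtotal_variation A B : A `<=` B -> (tv A <= tv B)%E.
Proof.
move=> AB; apply: ge_ereal_sup => _ [n [F [mF FD tF ->]]].
apply: ereal_sup_ubound; exists n, F; split => // k.
by apply: subset_trans (FD k) _; exact: setIS.
Qed.

(** Two finite families of pieces, one inside each of two disjoint sets,
    can be listed one after the other. *)
Lemma vtotal_variation_superadditive A B : A `&` B = set0 ->
  (tv A + tv B <= tv (A `|` B))%E.
Proof.
move=> AB.
suff h : forall a b, [set s : \bar R | exists (n : nat) (F : nat -> set R),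
    [/\ forall k, measurable (F k), forall k, F k `<=` D `&` A,
        trivIset setT F & s = (\sum_(k < n) `|mu (F k)|)%:E]] a ->
    [set s : \bar R | exists (n : nat) (F : nat -> set R),
    [/\ forall k, measurable (F k), forall k, F k `<=` D `&` B,
        trivIset setT F & s = (\sum_(k < n) `|mu (F k)|)%:E]] b ->
    (a + b <= tv (A `|` B))%E.
  have [->|fB] := eqVneq (tv (A `|` B)) +oo%E; first exact: leey.
  have fin X : X `<=` A `|` B -> (tv X) \is a fin_num.
    move=> XAB; rewrite ge0_fin_numE ?vtotal_variation_ge0//.
    by apply: le_lt_trans (le_vtotal_variation XAB) _; rewrite ltey.
  have fA := fin _ (@subsetUl _ A B).
  have fB' := fin _ (@subsetUr _ A B).
  rewrite addeC -leeBrDr//.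
  apply: ge_ereal_sup => b hb; rewrite leeBrDr// addeC -leeBrDr; last first.
    by case: hb => n [F [_ _ _ ->]].
  apply: ge_ereal_sup => a ha; rewrite leeBrDr//; first exact: h.
  by case: hb => n [F [_ _ _ ->]].
move=> _ _ [n [F [mF FD tF ->]]] [m [G [mG GD tG ->]]].
apply: ereal_sup_ubound.
exists (n + m)%N, (fun k => if (k < n)%N then F k else
  if (k < n + m)%N then G (k - n)%N else set0); split.
- by move=> k; case: ifP => // _; case: ifP.
- move=> k; case: ifP => _; first by apply: subset_trans (FD k) _; apply: setIS => x; left.
  by case: ifP => // _; apply: subset_trans (GD _) _; apply: setIS => x; right.
- have FG i j : F i `&` G j = set0.
    apply/seteqP; split => // x [/FD[_ Ax] /GD[_ Bx]].
    by rewrite -AB.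
  move=> i j _ _; case: (ltnP i n) => ni; case: (ltnP j n) => nj.
  + exact: tF.
  + by case: ifP => _; rewrite ?FG ?setI0 => -[?[]].
  + by case: ifP => _; rewrite setIC ?FG ?setI0 => -[?[]].
  + case: ifP => _; last by rewrite set0I => -[? []].
    case: ifP => _; last by rewrite setI0 => -[? []].
    by move=> /tG => /(_ I I) e; rewrite -(subnK ni) e subnK.
- congr EFin; rewrite big_split_ord/=; congr (_ + _); apply: eq_bigr => i _.
    by rewrite ltn_ord.
  by rewrite ltnNge leq_addr/= ltn_add2l ltn_ord addKn.
Qed.

Lemma vtotal_variation_sum (A : nat -> set R) n : trivIset setT A ->
  (\sum_(0 <= i < n) tv (A i) <= tv (\big[setU/set0]_(i < n) A i))%E.
Proof.
move=> tA; elim: n => [|n ih].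
  by rewrite big_geq// vtotal_variation_ge0.
rewrite big_nat_recr//= big_ord_recr/=.
apply: le_trans (vtotal_variation_superadditive _); first exact: leeD2r.
rewrite -bigcup_mkord setI_bigcupl bigcup0// => i /= iltn.
apply: contrapT => /eqP/set0P/tA => /(_ I I) ij.
by rewrite ij ltnn in iltn.
Qed.

(** The pieces of a partition of the union are cut along the sets [A i]; only
    finitely many pieces are summed, so the limit in the countable additivity of
    [mu] passes through the sum. *)
Lemma vtotal_variation_bigcup_le (A : nat -> set R) :
  (forall i, measurable (A i)) -> trivIset setT A ->
  (tv (\bigcup_i A i) <= \sum_(0 <= i <oo) tv (A i))%E.
Proof.
move=> mA tA; apply: ge_ereal_sup => _ [n [F [mF FD tF ->]]].
have cF k : (\sum_(i < N) mu (F k `&` A i)) @[N --> \oo] --> mu (F k).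
  have {2}-> : F k = \bigcup_i (F k `&` A i).
    rewrite -setI_bigcupr; apply/seteqP; split => [x Fx|x []//].
    by split => //; have [] := FD _ _ Fx.
  apply: muD => [i|i|].
  - exact: measurableI.
  - by move=> x [/FD[]].
  - by move=> i j _ _ [x [[_ Ai] [_ Aj]]]; apply: (tA i j) => //; exists x.
have c : (\sum_(k < n) `|\sum_(i < N) mu (F k `&` A i)|)%:E @[N --> \oo] -->
    (\sum_(k < n) `|mu (F k)|)%:E.
  apply: cvg_EFin; first by near=> N.
  apply: cvg_big => [|k _]; first exact: add_continuous.
  by apply: cvg_norm; exact: cF.
apply: cvge_le c; near=> N.
apply: (@le_trans _ _ (\sum_(0 <= i < N) tv (A i))%E); last first.
  by apply: nneseries_lim_ge => i _ _; exact: vtotal_variation_ge0.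
apply: (@le_trans _ _ (\sum_(k < n) \sum_(i < N) `|mu (F k `&` A i)|)%:E).
  by rewrite lee_fin; apply: ler_sum => k _; exact: ler_norm_sum.
rewrite exchange_big/= big_mkord -sumEFin; apply: lee_sum => i _.
apply: ereal_sup_ubound; exists n, (fun k => F k `&` A i); split => //.
- by move=> k; exact: measurableI.
- by move=> k x [/FD[]].
- by move=> j k _ _ [x [[Fj _] [Fk _]]]; apply: tF => //; exists x.
Unshelve. all: by end_near. Qed.

Lemma vtotal_variation_semi_sigma_additive : semi_sigma_additive tv.
Proof.
move=> A mA tA mUA.
have -> : tv (\bigcup_i A i) = (\sum_(0 <= i <oo) tv (A i))%E.
  apply/eqP; rewrite eq_le vtotal_variation_bigcup_le//=.
  apply: lime_le; first by apply: is_cvg_nneseries => i _ _; exact: vtotal_variation_ge0.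
  near=> n; apply: le_trans (vtotal_variation_sum _ tA) _.
  by apply: le_vtotal_variation; rewrite -bigcup_mkord => x [i _ Aix]; exists i.
by apply: is_cvg_nneseries => i _ _; exact: vtotal_variation_ge0.
Unshelve. all: by end_near. Qed.

End vector_measure_theory.

(** The total variation is a measure by virtue of the countable additivity of
    [mu]; the name keeps this proof as an argument so that the measure structure
    can be attached to it. *)
Definition vtotal_variation_measure {R : realType} {H : normedModType R}
  (D : set R) (mu : set R -> H) of vector_measure D mu := vtotal_variation D mu.

HB.instance Definition _ {R : realType} {H : normedModType R}
    (D : set R) (mu : set R -> H) (muD : vector_measure D mu) :=
  isMeasure.Build _ _ _ (vtotal_variation_measure muD)
    (vtotal_variation0 muD) (vtotal_variation_ge0 D mu)
    (vtotal_variation_semi_sigma_additive muD).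

(** * Simple functions and their integral *)

(** [vsimple] for maps into an arbitrary type of values: a pair or a boolean
    recording which piece of a partition a point lies in is such a map. *)
Definition simple_map {R : realType} {K : Type} (D : set R) (k : R -> K) :=
  finite_set (k @` D) /\ forall c, measurable (D `&` k @^-1` [set c]).

Section simple_map_theory.
Context {R : realType} (D : set R).

Lemma simple_map_pair (K L : Type) (k : R -> K) (l : R -> L) :
  simple_map D k -> simple_map D l -> simple_map D (fun x => (k x, l x)).
Proof.
move=> [fk mk] [fl ml]; split.
  apply: (sub_finite_set _ (finite_setX fk fl)) => _ [x Dx <-].
  by split => /=; exists x.
move=> [c d]; rewrite (_ : _ `&` _ = (D `&` k @^-1` [set c]) `&`
    (D `&` l @^-1` [set d])); first exact: measurableI.
by apply/seteqP; split => x /= [] => [Dx [-> ->]|[Dx ->] [_ ->]].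
Qed.

Lemma simple_map_preimage (K : Type) (k : R -> K) (Y : set K) :
  simple_map D k -> measurable (D `&` k @^-1` Y).
Proof.
move=> [fk mk]; rewrite (_ : _ `&` _ =
    \bigcup_(c in k @` D `&` Y) (D `&` k @^-1` [set c])).
  apply: fin_bigcup_measurable => [|c _]; last exact: mk.
  by apply: sub_finite_set fk => x [].
apply/seteqP; split => [x [Dx Yk]|x [c [_ Yc] [Dx kc]]].
  by exists (k x) => //; split => //; exists x.
by split => //; rewrite /= kc.
Qed.

Lemma simple_map_comp (K L : Type) (k : R -> K) (phi : K -> L) :
  simple_map D k -> simple_map D (fun x => phi (k x)).
Proof.
move=> sk; split; last by move=> c; exact: (simple_map_preimage (phi @^-1` [set c])).
by case: sk => fk _; rewrite -(image_comp k phi); exact: finite_image.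
Qed.

Lemma simple_map_mem (E : set R) : measurable D -> measurable E ->
  simple_map D (fun x => x \in E).
Proof.
move=> mD mE; split; first exact: finite_finset.
case.
  rewrite (_ : _ @^-1` _ = E); first exact: measurableI.
  by apply/seteqP; split => x /= => [/set_mem|/mem_set].
rewrite (_ : _ @^-1` _ = ~` E); first by apply: measurableI => //; exact: measurableC.
by apply/seteqP; split => x /=; [move=> + /mem_set => -> | exact: memNset].
Qed.

Lemma simple_map_measurable (K : Type) (k : R -> K) (phi : K -> R) :
  simple_map D k -> measurable_fun D (fun x => phi (k x)).
Proof.
move=> sk _ Y mY; exact: (simple_map_preimage (phi @^-1` Y)).
Qed.

Lemma simple_mapP (K : choiceType) (k : R -> K) : simple_map D k ->
  exists r : seq K, uniq r /\ forall x, D x -> k x \in r.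
Proof.
move=> [fk _]; exists (fset_set (k @` D)); split; first exact: fset_uniq.
by move=> x Dx; rewrite in_fset_set// inE; exists x.
Qed.

End simple_map_theory.

Section simple_integral.
Context {R : realType} {H : normedModType R} (ip : {dot H for idfun}).
Variables (D : set R) (mu : set R -> H).
Hypotheses (mD : measurable D) (muD : vector_measure D mu).

Local Notation vs := (vsintegral ip D mu).

Lemma measure_fibre (K : choiceType) (k : R -> K) (r : seq K) (Y : pred K) :
  simple_map D k -> uniq r -> (forall x, D x -> k x \in r) ->
  mu (D `&` k @^-1` [set c | Y c]) =
    \sum_(c <- r | Y c) mu (D `&` k @^-1` [set c]).
Proof.
move=> [fk mk] ur kr; rewrite -big_filter -(vector_measure_bigU muD)//.
- congr mu; rewrite -bigcup_seq; apply/seteqP; split => [x [Dx Yx]|x [c]].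
    by exists (k x) => //=; rewrite mem_filter Yx kr.
  by rewrite /= mem_filter => /andP[Yc _] [Dx kx]; split => //=; rewrite kx.
- exact: filter_uniq.
- by move=> c d _ _ [x [[_ <-] [_ <-]]].
Qed.

(** The algebra of integrals of simple functions reduces to this formula, applied
    to a partition on whose pieces all the functions involved are constant; the
    list [r] may contain values not taken, whose fibres are empty. *)
Lemma vsintegral_comp (K : choiceType) (k : R -> K) (phi : K -> H) (r : seq K) :
  simple_map D k -> uniq r -> (forall x, D x -> k x \in r) ->
  vs (fun x => phi (k x)) = \sum_(c <- r) ip (phi c) (mu (D `&` k @^-1` [set c])).
Proof.
move=> sk ur kr; set g := fun x => phi (k x).
have [fg mg] : simple_map D g by exact: simple_map_comp.
rewrite /vsintegral fsbig_finite//=; set s := fset_set _.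
have gs x : D x -> g x \in s by move=> Dx; rewrite in_fset_set// inE; exists x.
rewrite (eq_bigr (fun h => \sum_(c <- r | phi c == h)
    ip (phi c) (mu (D `&` k @^-1` [set c])))); last first.
  move=> h _; have -> : g @^-1` [set h] = k @^-1` [set c | phi c == h].
    by apply/seteqP; split => x /=; [move=> <-; rewrite eqxx | move/eqP].
  rewrite (measure_fibre _ sk ur kr) linear_sumr/=.
  by apply: eq_bigr => c /eqP ->.
rewrite (exchange_big_dep xpredT)//=; apply: eq_big_seq => c cr.
have [[x [Dx kx]]|/set0P/negP/negPn/eqP ->] :=
    pselect ((D `&` k @^-1` [set c]) !=set0); last first.
  by rewrite (vector_measure0 muD) big1 ?linear0r// => *; rewrite linear0r.
rewrite big_mkcond (bigD1_seq (phi c)) ?fset_uniq//=; last first.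
  by rewrite -kx; exact: gs.
by rewrite eqxx big1 ?addr0// => h hc; rewrite eq_sym (negbTE hc).
Qed.

Lemma eq_vsintegral (g h : R -> H) : (forall x, D x -> g x = h x) -> vs g = vs h.
Proof.
move=> gh; rewrite /vsintegral (_ : g @` D = h @` D); last first.
  by apply/seteqP; split => _ [x Dx <-]; exists x; rewrite // gh.
apply: eq_fsbigr => c _; congr (ip _ (mu _)).
by apply/seteqP; split => x [Dx] /= <-; rewrite gh.
Qed.

Lemma vsintegralD (g h : R -> H) : simple_map D g -> simple_map D h ->
  vs (fun x => g x + h x) = vs g + vs h.
Proof.
move=> sg sh; have sgh := simple_map_pair sg sh.
have [r [ur rP]] := simple_mapP sgh.
rewrite (vsintegral_comp (fun p => p.1 + p.2) sgh ur rP).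
rewrite (vsintegral_comp fst sgh ur rP) (vsintegral_comp snd sgh ur rP).
by rewrite -big_split/=; apply: eq_bigr => p _; rewrite linearDl.
Qed.

Lemma simple_map_restrict (E : set R) (g : R -> H) : measurable E ->
  simple_map D g -> simple_map D (fun x => \1_E x *: g x).
Proof.
move=> mE sg.
exact: (simple_map_comp (fun p : bool * H => p.1%:R *: p.2)
  (simple_map_pair (simple_map_mem mD mE) sg)).
Qed.

Lemma vsintegral_restrict (E : set R) (g : R -> H) (r : seq H) :
  measurable E -> E `<=` D ->
  simple_map D g -> uniq r -> (forall x, D x -> g x \in r) ->
  vs (fun x => \1_E x *: g x) = \sum_(c <- r) ip c (mu (E `&` g @^-1` [set c])).
Proof.
move=> mE ED sg ur rP.
have sEg := simple_map_pair (simple_map_mem mD mE) sg.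
rewrite (vsintegral_comp (fun p : bool * H => p.1%:R *: p.2)
  (r := [seq (b, c) | b <- [:: true; false], c <- r]) sEg); last 2 first.
- by rewrite allpairs_uniq// => -[? ?] [? ?].
- by move=> x Dx; apply: allpairs_f; [case: (_ \in E) | exact: rP].
rewrite big_allpairs !big_cons big_nil/= addr0 [X in _ + X]big1 ?addr0; last first.
  by move=> c _; rewrite scale0r linear0l.
apply: eq_bigr => c _; rewrite scale1r; congr (ip _ (mu _)).
apply/seteqP; split => x /= => [[Dx [/set_mem ? ?]]|[Ex <-]]//.
by split; [exact: ED | rewrite mem_set].
Qed.

Hypothesis hip : forall x : H, `|x| ^+ 2 = ip x x.

Lemma cvg_ipr (T : Type) (F : set_system T) {FF : Filter F} (c a : H) (f : T -> H) :
  f x @[x --> F] --> a -> ip c (f x) @[x --> F] --> ip c a.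
Proof.
move=> fa; apply/cvgrPdist_le => e e0.
have c0 : 0 < `|c| + 1 by rewrite ltr_wpDl.
have ec0 : 0 < e / (`|c| + 1) by rewrite divr_gt0.
move/cvgrPdist_le : fa => /(_ _ ec0); apply: filterS => x.
rewrite -linearBr ler_pdivlMr// => h.
apply: le_trans (ip_cauchy_schwarz hip _ _) _; apply: le_trans h.
by rewrite mulrC ler_wpM2l// lerDl.
Qed.

(** The integral over a piece is a finite sum of terms [ip c (mu _)], so it
    inherits countable additivity from [mu]. *)
Lemma vsintegral_bigcup (E : nat -> set R) (g : R -> H) :
  (forall n, measurable (E n)) -> (forall n, E n `<=` D) -> trivIset setT E ->
  simple_map D g ->
  (\sum_(k < n) vs (fun x => \1_(E k) x *: g x)) @[n --> \oo] -->
    vs (fun x => \1_(\bigcup_k E k) x *: g x).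
Proof.
move=> mE ED tE sg; have [r [ur rP]] := simple_mapP sg.
have UD : \bigcup_k E k `<=` D by exact: bigcup_sub.
rewrite (vsintegral_restrict _ UD sg ur rP); last exact: bigcupT_measurable.
under eq_fun => n.
  under eq_bigr => k _ do rewrite (vsintegral_restrict (mE k) (ED k) sg ur rP).
  rewrite exchange_big/=.
  under eq_bigr => c _ do rewrite -linear_sumr/=.
  over.
apply: cvg_big => [|c _]; first exact: add_continuous.
apply: cvg_ipr; rewrite setI_bigcupl; apply: muD => [n|n x [/ED]|]//.
  rewrite (_ : _ `&` _ = E n `&` (D `&` g @^-1` [set c])).
    by apply: measurableI => //; case: sg.
  by apply/seteqP; split => [x [Ex gx]|x [Ex [Dx gx]]]//; do ?split => //; exact: (ED n).
by move=> i j _ _ [x [[Ei _] [Ej _]]]; apply: tE => //; exists x.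
Qed.

Local Notation tv := (vtotal_variation_measure muD).

Lemma simple_map_norm_measurable (g : R -> H) : simple_map D g ->
  measurable_fun D (fun x => `|g x|).
Proof. exact: (simple_map_measurable (fun c : H => `|c|)). Qed.

Lemma integral_norm_simple (g : R -> H) (r : seq H) :
  simple_map D g -> uniq r -> (forall x, D x -> g x \in r) ->
  (\int[tv]_(x in D) `|g x|%:E =
    \sum_(c <- r) `|c|%:E * tv (D `&` g @^-1` [set c]))%E.
Proof.
move=> sg ur rP; set F := fun c => D `&` g @^-1` [set c].
have DF : D = \big[setU/set0]_(c <- r) F c.
  rewrite -bigcup_seq; apply/seteqP; split => [x Dx|x [c _ []]//].
  by exists (g x); [exact: rP | split].
have mF c : measurable (F c) by case: sg => _; exact.
transitivity (\int[tv]_(x in \big[setU/set0]_(c <- r) F c) `|g x|%:E)%E.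
  by rewrite -DF.
rewrite ge0_integral_bigsetU//.
- apply: eq_bigr => c _.
  rewrite -integral_cst; last exact: mF.
  apply: eq_integral => x.
  by rewrite inE => -[_ /= ->].
- by move=> c d _ _ [x [[_ <-] [_ <-]]].
- by rewrite -DF; apply/measurable_EFinP; exact: simple_map_norm_measurable.
Qed.

Lemma vsintegral_le (g : R -> H) : simple_map D g ->
  (`|vs g|%:E <= \int[tv]_(x in D) `|g x|%:E)%E.
Proof.
move=> sg; have [r [ur rP]] := simple_mapP sg.
rewrite (integral_norm_simple sg ur rP) (vsintegral_comp id sg ur rP).
apply: (@le_trans _ _ (\sum_(c <- r) (`|c| * `|mu (D `&` g @^-1` [set c])|)%:E)%E).
  rewrite sumEFin lee_fin; apply: le_trans (ler_norm_sum _ _ _) _.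
  by apply: ler_sum => c _; exact: ip_cauchy_schwarz.
apply: lee_sum => c _; rewrite EFinM lee_wpmul2l ?lee_fin//.
by apply: vtotal_variation_ge => [|x []]//; case: sg.
Qed.

Lemma vsintegral_set1 (g : R -> H) t : D t -> simple_map D g ->
  vs (fun x => \1_[set t] x *: g x) = ip (g t) (mu [set t]).
Proof.
move=> Dt sg; have [r [ur rP]] := simple_mapP sg.
have tD : [set t] `<=` D by move=> x ->.
rewrite (vsintegral_restrict _ tD sg ur rP)//.
rewrite (bigD1_seq (g t)) ?rP//= big1 ?addr0 => [|c cgt].
  congr (ip _ (mu _)); apply/seteqP; split => x.
    by case.
  by move=> /= ->; split.
rewrite (_ : _ `&` _ = set0) ?(vector_measure0 muD) ?linear0r//.
by apply/seteqP; split => // x [-> /=] gtc; rewrite gtc eqxx in cgt.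
Qed.

(** * The integral as a limit of integrals of simple functions *)

Lemma strongly_measurable_dist (g h : R -> H) :
  strongly_measurable D g -> strongly_measurable D h ->
  measurable_fun D (fun x => `|g x - h x|%:E).
Proof.
move=> [gn [sgn gng]] [hn [shn hnh]]; apply/measurable_EFinP.
apply: (@measurable_fun_cvg _ _ _ _ (fun n x => `|gn n x - hn n x|)) => [n|x Dx].
  exact: (simple_map_measurable (fun p : H * H => `|p.1 - p.2|)
    (simple_map_pair (sgn n) (shn n))).
by apply: cvg_norm; apply: cvgB; [exact: gng | exact: hnh].
Qed.

Lemma simple_strongly_measurable (g : R -> H) :
  simple_map D g -> strongly_measurable D g.
Proof. by move=> sg; exists (fun=> g); split => // x Dx; exact: cvg_cst. Qed.

Lemma strongly_measurable_restrict (E : set R) (g : R -> H) : measurable E ->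
  strongly_measurable D g -> strongly_measurable D (fun x => \1_E x *: g x).
Proof.
move=> mE [gn [sgn gng]]; exists (fun n x => \1_E x *: gn n x).
split => [n|x Dx]; first exact: (simple_map_restrict mE (sgn n)).
by apply: cvgZr; exact: gng.
Qed.

(** Both the uniqueness of the integral of [g] and its existence along any sequence
    of simple functions converging to [g] in mean come from this estimate. *)
Lemma vsintegral_dist (g h1 h2 : R -> H) :
  strongly_measurable D g -> simple_map D h1 -> simple_map D h2 ->
  (`|vs h1 - vs h2|%:E <= \int[tv]_(x in D) `|h1 x - g x|%:E +
                          \int[tv]_(x in D) `|h2 x - g x|%:E)%E.
Proof.
move=> mg s1 s2.
have s12 : simple_map D (fun x => h1 x - h2 x).
  exact: (simple_map_comp (fun p : H * H => p.1 - p.2) (simple_map_pair s1 s2)).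
have -> : vs h1 - vs h2 = vs (fun x => h1 x - h2 x).
  apply/eqP; rewrite subr_eq -vsintegralD//; apply/eqP/eq_vsintegral => x _.
  by rewrite subrK.
have m1 := strongly_measurable_dist (simple_strongly_measurable s1) mg.
have m2 := strongly_measurable_dist (simple_strongly_measurable s2) mg.
apply: le_trans (vsintegral_le s12) _.
rewrite -ge0_integralD//; apply: ge0_le_integral => //.
- by apply/measurable_EFinP; exact: simple_map_norm_measurable.
- exact: emeasurable_funD.
- by move=> x _; rewrite -EFinD lee_fin (distrC (h2 x)); exact: ler_distD.
Qed.

Lemma cvge0_lt (a : (\bar R)^nat) e : a @ \oo --> 0%E -> 0 < e ->
  \forall n \near \oo, (a n < e%:E)%E.
Proof.
move=> /fine_cvgP[fa /cvgrPdist_lt ca] /ca; apply: filterS2 fa => n fan.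
by rewrite sub0r normrN => h; rewrite -(fineK fan) lte_fin; apply: le_lt_trans h; exact: ler_norm.
Qed.

Lemma is_vintegral_unique (g : R -> H) v w :
  is_vintegral ip D mu g v -> is_vintegral ip D mu g w -> v = w.
Proof.
move=> [mg [h [sh ch vh]]] [_ [k [sk ck wk]]].
have c0 : (`|vs (h n) - vs (k n)|%:E)%E @[n --> \oo] --> 0%E.
  apply: (@squeeze_cvge _ _ _ _ (fun=> 0%E) _ (fun n => \int[tv]_(x in D) `|h n x - g x|%:E +
                          \int[tv]_(x in D) `|k n x - g x|%:E)%E).
  - near=> n; rewrite lee_fin normr_ge0 andTb; exact: (vsintegral_dist mg (sh n) (sk n)).
  - exact: cvg_cst.
  - by rewrite -[X in _ --> X]adde0; apply: cvgeD.
have /fine_cvgP[_] := c0; rewrite [_ \o _]/= => d0.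
have d1 : `|vs (h n) - vs (k n)| @[n --> \oo] --> `|v - w|.
  by apply: cvg_norm; exact: cvgB.
have := cvg_lim (@norm_hausdorff _ R) d1.
rewrite (cvg_lim (@norm_hausdorff _ R) d0) => vw0.
by apply/eqP; rewrite -subr_eq0 -normr_eq0 -vw0.
Unshelve. all: by end_near. Qed.

(** Integrals of simple functions converging in mean form a Cauchy sequence. *)
Lemma is_vintegral_exists (g : R -> H) (h : nat -> R -> H) :
  strongly_measurable D g -> (forall n, simple_map D (h n)) ->
  (\int[tv]_(x in D) `|h n x - g x|%:E)%E @[n --> \oo] --> 0%E ->
  exists2 v, is_vintegral ip D mu g v & vs (h n) @[n --> \oo] --> v.
Proof.
move=> mg sh ch.
suff /cvg_ex[v vh] : cvgn (fun n => vs (h n)) by exists v => //; split => //; exists h.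
apply/cauchy_cvgP/cauchy_exP => e e0.
have [N _ NP] := cvge0_lt ch (divr_gt0 e0 (ltr0n _ 2)).
exists (vs (h N)), N => // n /= Nn; rewrite -ball_normE /ball_/= -lte_fin.
apply: le_lt_trans (vsintegral_dist mg (sh N) (sh n)) _.
by rewrite [e in X in (_ < X)%E]splitr EFinD; apply: lteD; apply: NP => //=.
Qed.

Lemma simple_set1_le_integral (g h : R -> H) t : D t ->
  strongly_measurable D g -> simple_map D h -> ip (g t) (mu [set t]) <= 0 ->
  ((vs (fun x => \1_[set t] x *: h x))%:E <=
     \int[tv]_(x in [set t]) `|h x - g x|%:E)%E.
Proof.
move=> Dt mg sh g0; rewrite vsintegral_set1//.
rewrite (@eq_integral _ _ _ _ _ (cst `|h t - g t|%:E)); last first.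
  by move=> x; rewrite inE => ->.
rewrite integral_cst//; apply: (@le_trans _ _ (`|h t - g t| * `|mu [set t]|)%:E).
  rewrite lee_fin; apply: le_trans (ip_cauchy_schwarz hip _ _).
  by apply: le_trans (ler_norm _); rewrite linearBl/= lerDl oppr_ge0.
rewrite EFinM lee_wpmul2l ?lee_fin//.
by apply: vtotal_variation_ge => // x ->.
Qed.

(** Atom by atom, replacing [h t] by [g t] costs at most the integral of
    [`|h x - g x|] over [[set t]]; the total cost over the disjoint atoms is at most
    the integral over [D]. *)
Lemma simple_countable_le_integral (S : set R) (g h : R -> H) :
  countable S -> S `<=` D ->
  strongly_measurable D g -> simple_map D h ->
  (forall t, S t -> ip (g t) (mu [set t]) <= 0) ->
  ((vs (fun x => \1_S x *: h x))%:E <= \int[tv]_(x in D) `|h x - g x|%:E)%E.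
Proof.
move=> /countable_injP[f finj] SD mg sh g0.
(* [f] numbers the points of [S]: each [E k] is empty or a singleton *)
pose E k := S `&` f @^-1` [set k].
have Ecase k : E k = set0 \/ exists2 t, S t & E k = [set t].
  have [[t [St ft]]|/set0P/negP/negPn/eqP ->] := pselect (E k !=set0); last by left.
  right; exists t => //; apply/seteqP; split => [x [Sx fx]|x ->]; last by split.
  by apply: finj; rewrite ?inE// fx ft.
have mE k : measurable (E k) by have [->|[t _ ->]] := Ecase k.
have ED k : E k `<=` D by move=> x [/SD].
have tE : trivIset setT E by move=> i j _ _ [x [[_ /= <-] [_ /= <-]]].
have SE : S = \bigcup_k E k.
  by apply/seteqP; split => [x Sx|x [k _ []]//]; exists (f x).
have md := strongly_measurable_dist (simple_strongly_measurable sh) mg.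
have c := vsintegral_bigcup mE ED tE sh.
rewrite -SE in c.
have c' : (\sum_(k < n) vs (fun x => \1_(E k) x *: h x))%:E @[n --> \oo] -->
    (vs (fun x => \1_S x *: h x))%:E by apply: cvg_EFin => //; near=> n.
apply: cvge_le c'; near=> n.
have UD : \big[setU/set0]_(k < n) E k `<=` D.
  by rewrite -bigcup_mkord; apply: bigcup_sub => k _; exact: ED.
apply: (@le_trans _ _ (\int[tv]_(x in \big[setU/set0]_(k < n) E k) `|h x - g x|%:E)%E);
  last first.
  by apply: ge0_subset_integral => //; apply: bigsetU_measurable.
rewrite -(big_mkord xpredT) ge0_integral_bigsetU//.
- rewrite big_mkord -sumEFin; apply: lee_sum => k _.
  have [->|[t St ->]] := Ecase k.
    rewrite integral_set0 (eq_vsintegral (h := fun=> 0)) => [|x _]; last first.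
      by rewrite indic0 scale0r.
    rewrite /vsintegral (_ : (\sum_(i \in _) _)%R = 0)//.
    by apply: fsbig1 => _ [x _ <-]; rewrite linear0l.
  by apply: simple_set1_le_integral; [exact: SD|..|exact: g0].
- exact: iota_uniq.
- exact: sub_trivIset tE.
- by rewrite big_mkord; apply: measurable_funS md.
Unshelve. all: by end_near. Qed.

(** What the countable set [D `\` C] contributes to the integrals of the
    approximating simple functions is at most their distance to [g] in mean, which
    tends to [0]. *)
Lemma is_vintegral_cocountable (C : set R) (g : R -> H) v :
  measurable C -> C `<=` D -> countable (D `\` C) ->
  (forall t, (D `\` C) t -> ip (g t) (mu [set t]) <= 0) ->
  is_vintegral ip D mu g v ->
  exists2 w, is_vintegral ip D mu (fun x => \1_C x *: g x) w & v <= w.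
Proof.
move=> mC CD cS g0 [mg [h [sh ch vh]]].
have mC' := strongly_measurable_restrict mC mg.
have md n := strongly_measurable_dist (simple_strongly_measurable (sh n)) mg.
have sC n := simple_map_restrict mC (sh n).
have [|w wC ww] := is_vintegral_exists mC' sC.
  apply: squeeze_cvge (ch) => //; [|exact: cvg_cst].
  near=> n; rewrite integral_ge0//=; apply: ge0_le_integral => //.
  - exact: strongly_measurable_dist (simple_strongly_measurable _) mC'.
  - move=> x _; rewrite lee_fin -scalerBr normrZ ler_piMl//.
    by rewrite indicE; case: (_ \in _); rewrite ?normr1 ?normr0.
exists w => //; rewrite -subr_le0 -lee_fin.
pose S := D `\` C.
have mS : measurable S by exact: measurableD.
have split_vs n : vs (h n) - vs (fun x => \1_C x *: h n x) =
    vs (fun x => \1_S x *: h n x).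
  apply/eqP; rewrite subr_eq addrC -(vsintegralD (sC n) (simple_map_restrict mS (sh n))).
  apply/eqP/eq_vsintegral => x Dx; rewrite -scalerDl !indicE.
  have [xC|xC] := boolP (x \in C).
    by rewrite memNset ?addr0 ?scale1r// => -[_]; apply; exact: set_mem.
  by rewrite mem_set ?add0r ?scale1r//; split => // Cx; rewrite mem_set in xC.
have cS' : ((vs (fun x => \1_S x *: h n x))%:E)%E @[n --> \oo] --> (v - w)%:E.
  apply: cvg_EFin; first by near=> n.
  by under eq_fun do rewrite /= -split_vs; exact: cvgB.
have c0 : (\int[tv]_(x in D) `|h n x - g x|%:E)%E @[n --> \oo] --> 0%E := ch.
apply: (lee_cvg_to cS' c0); near=> n.
apply: simple_countable_le_integral => //; last exact: sh.
by move=> x [].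
Unshelve. all: by end_near. Qed.

End simple_integral.

(** * Discontinuities of functions of bounded variation *)

Section bv_discontinuities.
Context {R : realType} {H : normedModType R}.
Variables (T : R) (f : R -> H).

Fixpoint path_variation (x : R) (s : seq R) : R :=
  if s is y :: s' then `|f y - f x| + path_variation y s' else 0.

Lemma path_variationE x s : path_variation x s =
  \sum_(j < size s) `|f (nth 0 (x :: s) j.+1) - f (nth 0 (x :: s) j)|.
Proof.
elim: s x => [|y s ih] x /=; first by rewrite big_ord0.
by rewrite big_ord_recl/= ih; congr (_ + _); apply: eq_bigr.
Qed.

Lemma path_variation_le (x : R) (s : seq R) : s != [::] -> path <%R x s ->
  all (fun y => y \in `[0, T]) (x :: s) ->
  ((path_variation x s)%:E <= pvariation T f)%E.
Proof.
move=> s0 ps sT; apply: ereal_sup_ubound.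
exists (size s), (nth 0 (x :: s)); split.
- by case: s s0 {ps sT}.
- by move=> j js; apply: (allP sT); rewrite mem_nth.
- by move=> j js; have /pathP := ps; apply.
- by rewrite path_variationE.
Qed.

Definition oscillates (e t : R) := forall d, 0 < d ->
  exists s, [/\ s \in `[0, T], `|s - t| < d & e <= `|f s - f t|].

(** Near each of finitely many points where [f] oscillates by [e] there is a pair
    of points realizing the oscillation; pairs chosen close enough to their
    centres are disjoint and can be joined into a single partition.  The bound [b]
    separates the pairs already placed from the next ones. *)
Lemma oscillation_partition (e : R) (ts : seq R) (b : R) : 0 < e -> path <%R b ts ->
  {in ts, forall t, t \in `[0, T] /\ oscillates e t} ->
  exists s, [/\ path <%R b s, all (fun y => y \in `[0, T]) s,
    (size s = (size ts).*2)%N &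
    e *+ size ts <= if s is x :: s' then path_variation x s' else 0].
Proof.
move=> e0; elim: ts b => [|t ts ih] b; first by exists [::].
move=> /= /andP[bt pts] osc.
have [tT osct] : t \in `[0, T] /\ oscillates e t.
  by apply: osc; rewrite mem_head.
have [d [d0 dtb dts]] : exists d, [/\ 0 < d, d <= t - b & path <%R (t + d) ts].
  case: ts pts {ih osc} => [|t' ts] /=.
    by move=> _; exists (t - b); rewrite subr_gt0 bt lexx.
  move=> /andP[tt' pts]; exists (Num.min (t - b) ((t' - t) / 2)); split.
  - by rewrite lt_min subr_gt0 bt/= divr_gt0// subr_gt0.
  - by rewrite ge_min lexx.
  - rewrite pts andbT; have : Num.min (t - b) ((t' - t) / 2) <= (t' - t) / 2.
      by rewrite ge_min lexx orbT.
    lra.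
have [s [sT sd fst]] := osct _ d0.
have st : s != t.
  by apply: contraTneq fst => ->; rewrite subrr normr0 -ltNge.
have := sd; rewrite ltr_norml => /andP[sd1 sd2].
pose lo := Num.min s t; pose hi := Num.max s t.
have lohi : lo < hi by move: (st); rewrite /lo /hi; case: (ltgtP s t).
have blo : b < lo by rewrite lt_min bt andbT; lra.
have hid : hi < t + d by rewrite gt_max; apply/andP; split; lra.
have flohi : `|f hi - f lo| = `|f s - f t|.
  by rewrite /lo /hi; case: (ltgtP s t) => [||->]// _; rewrite distrC.
have loT : lo \in `[0, T] by rewrite /lo; case: ltP.
have hiT : hi \in `[0, T] by rewrite /hi; case: ltP.
have [||s' [ps' s'T ss' es']] := ih hi.
- by case: (ts) dts => //= t' ts' /andP[h ->]; rewrite (lt_trans hid h).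
- by move=> u uts; apply: osc; rewrite inE uts orbT.
(* The link from [hi] to the first point of [s'] only adds to the variation. *)
exists [:: lo, hi & s']; split => /=.
- by rewrite blo lohi.
- by rewrite loT hiT.
- by rewrite ss' doubleS.
- rewrite mulrS flohi lerD//; apply: le_trans es' _.
  by case: s' {ps' s'T ss'} => // x s'; rewrite lerDr.
Qed.

Hypothesis fBV : BV T f.

Lemma oscillates_finite (e : R) : 0 < e ->
  finite_set [set t | t \in `[0, T] /\ oscillates e t].
Proof.
move=> e0; apply: contrapT => inf.
have big N : (0 < N)%N -> ((e *+ N)%:E <= pvariation T f)%E.
  move=> N0; have [B BA NB] := infinite_set_fset N inf.
  pose ts := take N (sort <=%R B).
  have sts : size ts = N by rewrite size_takel// size_sort.
  have uts : sorted <%R ts.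
    apply: take_sorted; rewrite lt_sorted_uniq_le sort_uniq fset_uniq.
    exact: sort_le_sorted.
  have tsA : {in ts, forall t, t \in `[0, T] /\ oscillates e t}.
    by move=> t /mem_take; rewrite mem_sort => /BA.
  case E : ts => [|t ts']; first by rewrite E in sts; rewrite -sts in N0.
  have pts : path <%R (t - 1) ts.
    by rewrite E/= ltrBlDr ltrDl ltr01/=; rewrite E in uts.
  have [[|x s] [ps sT ss es]] := oscillation_partition e0 pts tsA.
    by move: ss; rewrite /= sts; case: (N) N0.
  apply: (@le_trans _ _ (path_variation x s)%:E).
    by rewrite lee_fin -sts.
  apply: path_variation_le => //; last by case/andP: ps.
  by case: (s) ss => //=; rewrite sts; case: (N) N0 => // -[].
have /= [r pr] : exists r, pvariation T f = r%:E.
  move: fBV (big 1%N isT); rewrite /BV; case: (pvariation T f) => // r _ _.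
  by exists r.
have [n nr] : exists n : nat, r < e *+ n.+1.
  by exists (Num.truncn (r / e)); rewrite -mulr_natl -ltr_pdivrMr// truncnS_gt.
by have := big n.+1 isT; rewrite pr lee_fin leNgt nr.
Qed.

Lemma countable_Discont : countable (Discont T f).
Proof.
apply: (@sub_countable _ _ _
    (\bigcup_n [set t | t \in `[0, T] /\ oscillates n.+1%:R^-1 t])); last first.
  apply: bigcup_countable => // n _; apply: finite_set_countable.
  by apply: oscillates_finite; rewrite invr_gt0.
apply: subset_card_le => t [tT nCt]; apply: contrapT => nosc; apply: nCt.
split => //; apply/cvgrPdist_lt => eps eps0.
have [N _ NP] := near_infty_natSinv_lt (PosNum eps0).
have /existsNP[d /not_implyP[d0 dP]] : ~ oscillates N.+1%:R^-1 t.
  by move=> osc; apply: nosc; exists N.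
have td : \forall s \near t, `|t - s| < d.
  by apply/nbhs_ballP; exists d => //= s; rewrite -ball_normE.
rewrite near_withinE; apply: filterS td => s std sT.
rewrite distrC; apply: lt_trans (NP N (leqnn N)); rewrite ltNge; apply/negP => h.
by apply: dP; exists s; rewrite (distrC s).
Qed.

End bv_discontinuities.

(** * One-sided limits and the differential measure *)

Section one_sided_limits.
Context {R : realType} {H : normedModType R}.
Implicit Types (f g : R -> H) (T s t : R).

Lemma eq_near_lim (F : set_system R) {FF : Filter F} f g :
  (\forall x \near F, f x = g x) -> lim (f x @[x --> F]) = lim (g x @[x --> F]).
Proof.
move=> fg; congr lim; apply/seteqP; split => A; apply: filterS2 fg => x.
  by rewrite /= => ->.
by rewrite /= => ->.
Qed.

Lemma limp_Cont T f t : Cont T f t -> limp T f t = f t.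
Proof.
rewrite /limp => -[/itvP tT fct]; case: eqVneq => [->//|tneT].
have tltT : t < T by rewrite lt_neqAle tneT tT.
apply: cvg_lim; first exact: norm_hausdorff.
apply: cvg_trans fct; apply: cvg_app => A tA.
have {}tA : \forall s \near t^'+, s \in `[0, T] -> A s.
  have : \forall s \near t, s \in `[0, T] -> A s by [].
  by rewrite near_withinE; apply: filterS => s + _.
near=> s.
have : s \in `[0, T] -> A s by near: s.
apply; rewrite in_itv/=; apply/andP; split.
  have ts : t < s by near: s; exact: nbhs_right_gt.
  by apply: le_trans (ltW ts); rewrite tT.
by near: s; exact: nbhs_right_le.
Unshelve. all: by end_near. Qed.

Lemma limm_Cont T f t : Cont T f t -> limm f t = f t.
Proof.
rewrite /limm => -[/itvP tT fct]; case: eqVneq => [->//|tne0].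
have t0 : 0 < t by rewrite lt_neqAle eq_sym tne0 tT.
apply: cvg_lim; first exact: norm_hausdorff.
apply: cvg_trans fct; apply: cvg_app => A tA.
have {}tA : \forall s \near t^'-, s \in `[0, T] -> A s.
  have : \forall s \near t, s \in `[0, T] -> A s by [].
  by rewrite near_withinE; apply: filterS => s + _.
near=> s.
have : s \in `[0, T] -> A s by near: s.
apply; rewrite in_itv/=; apply/andP; split.
  by near: s; exact: nbhs_left_ge.
have st : s < t by near: s; exact: nbhs_left_lt.
by rewrite (le_trans (ltW st))// tT.
Unshelve. all: by end_near. Qed.

Definition update f t c := fun x => if x == t then c else f x.

Lemma limp_update T f t c s : t != T -> limp T (update f t c) s = limp T f s.
Proof.
move=> tT; rewrite /limp; case: eqVneq => _; first by rewrite /update eq_sym (negbTE tT).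
apply: eq_near_lim; have [st|ts] := ltP s t.
  near=> x; rewrite /update lt_eqF//; near: x; exact: nbhs_right_lt.
near=> x; rewrite /update gt_eqF//; apply: le_lt_trans ts _; near: x.
exact: nbhs_right_gt.
Unshelve. all: by end_near. Qed.

Lemma limm_update f t c s : t != 0 -> limm (update f t c) s = limm f s.
Proof.
move=> t0; rewrite /limm; case: eqVneq => _.
  by rewrite /update eq_sym (negbTE t0).
apply: eq_near_lim; have [st|ts] := ltP t s.
  near=> x; rewrite /update gt_eqF//; near: x; exact: nbhs_left_gt.
near=> x; rewrite /update lt_eqF//; apply: lt_le_trans ts; near: x.
exact: nbhs_left_lt.
Unshelve. all: by end_near. Qed.

(** A partition visits [t] at most once, so it sees at most two jumps to or from
    the new value. *)
Lemma BV_update T f t c : BV T f -> BV T (update f t c).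
Proof.
rewrite /BV => fBV; pose K := `|c - f t|.
apply: (@le_lt_trans _ _ (pvariation T f + (K + K)%:E)%E); last first.
  by move: fBV; case: (pvariation T f) => //= r _; rewrite ltry.
apply: ge_ereal_sup => _ [m [p [m0 pT ps ->]]].
apply: (@le_trans _ _ ((\sum_(j < m) `|f (p j.+1) - f (p j)|)%:E + (K + K)%:E)%E);
  last by apply: leeD2r; apply: ereal_sup_ubound; exists m, p.
rewrite -EFinD lee_fin.
have pinj i j : (i <= m)%N -> (j <= m)%N -> p i = p j -> i = j.
  have mono k l : (l <= m)%N -> (k < l)%N -> p k < p l.
    elim: l => // l ih lm; rewrite ltnS leq_eqVlt => /predU1P[->|kl].
      exact: ps.
    by apply: lt_trans (ps _ lm); apply: ih => //; exact: ltnW.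
  move=> im jm pij; case: (ltngtP i j) => // ij.
    by have := mono _ _ jm ij; rewrite pij ltxx.
  by have := mono _ _ im ij; rewrite pij ltxx.
have once (q : nat -> nat) : (forall j : 'I_m, (q j <= m)%N) -> injective q ->
    \sum_(j < m) (if p (q j) == t then K else 0) <= K.
  move=> qm qi; have [[i pit]|no] := pselect (exists i : 'I_m, p (q i) = t); last first.
    rewrite big1 ?normr_ge0// => j _; case: eqP => // pjt.
    by case: no; exists j.
  rewrite (bigD1 i)//= pit eqxx big1 ?addr0// => j ji; case: eqP => // pjt.
  have /qi/val_inj ij : q j = q i by apply: pinj; rewrite ?qm// pjt.
  by rewrite ij eqxx in ji.
apply: (@le_trans _ _ (\sum_(j < m) (`|f (p j.+1) - f (p j)| +
    ((if p j.+1 == t then K else 0) + (if p j == t then K else 0))))).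
  apply: ler_sum => j _; rewrite /update.
  case: eqP => [->|_]; case: eqP => [->|_]; rewrite ?addr0 ?add0r//.
  - by rewrite subrr normr0 ?addr_ge0 ?normr_ge0.
  - by rewrite [leRHS]addrC; exact: ler_distD.
  - by rewrite /K (distrC c); exact: ler_distD.
rewrite !big_split/= lerD2l lerD//.
  by apply: (once succn) => [j|j k []//]; exact: ltn_ord.
by apply: (once id) => // j; exact: ltnW.
Qed.

End one_sided_limits.

Section differential_measure_theory.
Context {R : realType} {H : normedModType R}.
Implicit Types (f : R -> H) (T t : R).

Lemma differential_measure_update T f t c : t != 0 -> t != T ->
  differential_measure T (update f t c) = differential_measure T f.
Proof.
move=> t0 tT; congr xget; apply/funext => mu; apply/propext.
by split => -[? ? muf]; split => // a b aT bT ab; move: (muf a b aT bT ab);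
  rewrite !limm_update// !limp_update.
Qed.

Lemma differential_measure_set1 T f mu t : 0 < T -> is_differential_measure T f mu ->
  t \in `[0, T] -> mu [set t] = limp T f t - limm f t.
Proof.
move=> T0 [muD _ mui] tT.
have T0T : (0 : R) \in `[0, T] by rewrite in_itv/= lexx ltW.
have TT : T \in `[0, T] by rewrite in_itv/= lexx ltW.
have t1D : [set t] `<=` `[0, T] by move=> x ->.
have [t0|tne0] := eqVneq t 0.
  rewrite t0 in t1D *.
  have [_ mucc _ muoc] := mui _ _ T0T TT T0.
  have disj : [set 0] `&` `]0, T] = set0.
    by apply/seteqP; split => // x [/= ->]; rewrite in_itv/= ltxx.
  have ocD : `]0, T] `<=` `[0, T] by apply: subset_itvr; rewrite bnd_simp.
  have := vector_measureU muD (measurable_set1 0) (measurable_itv `]0, T]) t1D ocD disj.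
  rewrite setU1itv ?bnd_simp ?ltW// mucc muoc => /esym/(canRL (addrK _)) ->.
  by rewrite opprB addrC addrA subrK.
have t0 : 0 < t by rewrite lt_neqAle eq_sym tne0 (itvP tT).
have [_ mucc muco _] := mui _ _ T0T tT t0.
have disj : `[0, t[ `&` [set t] = set0.
  by apply/seteqP; split => // x [/= + xt]; rewrite xt in_itv/= ltxx andbF.
have coD : `[0, t[ `<=` `[0, T].
  by apply: subset_itvl; rewrite bnd_simp (itvP tT).
have := vector_measureU muD (measurable_itv `[0, t[) (measurable_set1 t) coD t1D disj.
rewrite setUitv1 ?bnd_simp ?ltW// mucc muco (addrC _ (mu [set t])) => /esym/(canRL (addrK _)) ->.
by rewrite opprB addrA subrK.
Qed.

Lemma vector_measure_zero (D : set R) : vector_measure D (fun=> 0 : H).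
Proof.
move=> F _ _ _; apply: cvg_near_cst; near=> n; exact: big1.
Unshelve. all: by end_near. Qed.

(** When [f] has no differential measure the default value [0] is a vector measure
    without atoms, so both cases can be treated alike. *)
Lemma differential_measureP T f : 0 < T ->
  vector_measure `[0, T] (differential_measure T f) /\
  forall t, t \in `[0, T] ->
    differential_measure T f [set t] = limp T f t - limm f t \/
    differential_measure T f [set t] = 0.
Proof.
move=> T0; rewrite /differential_measure; case: xgetP => [mu _ [muf mufin mui]|_].
  split => // t tT; left; exact: differential_measure_set1.
by split; [exact: vector_measure_zero | right].
Qed.

End differential_measure_theory.

(** * The play operator *)

Section integral_sign.
Context {R : realType} {H : normedModType R} (ip : {dot H for idfun}).
Hypothesis hip : forall x : H, `|x| ^+ 2 = ip x x.

Lemma vintegral_on_le0_cocountable (D C C' : set R) (mu : set R -> H) (g : R -> H) :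
  measurable D -> vector_measure D mu ->
  C' `<=` C -> C `<=` D -> countable (C `\` C') ->
  (forall t, (C `\` C') t -> ip (g t) (mu [set t]) <= 0) ->
  vintegral_on ip D mu C' g <= 0 -> vintegral_on ip D mu C g <= 0.
Proof.
move=> mD muD C'C CD cN g0 vC'.
rewrite /vintegral_on /vintegral; case: xgetP => // v _ gv.
have mN : measurable (C `\` C') by apply: countable_measurable.
have DN : D `\` (D `\` (C `\` C')) = C `\` C'.
  by rewrite setDD; apply: setIidr => x [/CD].
have cDN : countable (D `\` (D `\` (C `\` C'))) by rewrite DN.
have [t|w gw vw] := is_vintegral_cocountable mD muD hip (measurableD mD mN)
    (@subDsetl _ _ _) cDN _ gv.
  rewrite DN => Nt; rewrite indicE mem_set ?scale1r; first exact: g0.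
  by case: Nt.
apply: le_trans vw _; rewrite -(_ : vintegral_on ip D mu C' g = w)//.
rewrite /vintegral_on.
have -> : (fun x => \1_C' x *: g x) =
    (fun x => \1_(D `\` (C `\` C')) x *: (\1_C x *: g x)).
  apply/funext => x; rewrite scalerA; congr (_ *: _).
  rewrite -[RHS]/((\1_(D `\` (C `\` C')) \* \1_C) x) -indicI.
  congr (\1_(_) x).
  apply/seteqP; split => [y C'y|y [[_ /not_andP[]// nC'] Cy]].
    by split; [split; [exact/CD/C'C | case] | exact: C'C].
  exact: contrapT.
have gw' := xgetPex 0 (ex_intro _ w gw).
exact: (is_vintegral_unique mD muD hip gw' gw).
Qed.

End integral_sign.

Section strongly_measurable_update.
Context {R : realType} {H : normedModType R}.

Lemma Linfty_update (D : set R) (z : R -> H) t c : measurable D ->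
  Linfty D z -> Linfty D (update z t c).
Proof.
move=> mD [[zn [szn znz]] [M zM]]; split; last first.
  exists (Num.max M `|c|) => x Dx; rewrite /update; case: ifP => _.
    by rewrite le_max lexx orbT.
  by rewrite le_max zM.
exists (fun n => update (zn n) t c); split => [n|x Dx].
  have -> : update (zn n) t c = fun x => if x \in [set t] then c else zn n x.
    apply/funext => x; congr (if _ then _ else _).
    by apply/eqP/idP => [->|/set_mem//]; exact: mem_set.
  exact: (simple_map_comp (fun p : bool * H => if p.1 then c else p.2)
    (simple_map_pair (simple_map_mem mD (measurable_set1 t)) (szn n))).
rewrite /update; case: ifP => _; first exact: cvg_cst.
exact: znz.
Qed.

End strongly_measurable_update.

Section play.
Context {R : realType} {H : completeNormedModType R} (ip : {dot H for idfun}).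
Hypothesis hip : forall x : H, `|x| ^+ 2 = ip x x.
Variables (Z : set H) (T : R).
Hypothesis T0 : 0 < T.
Implicit Types (u y : R -> H).

Let mT : measurable `[0, T]%classic.
Proof. exact: measurable_itv. Qed.

(** The interval has positive Lebesgue measure, so a countable set of
    discontinuities does not exhaust it. *)
Lemma common_continuity_point u y : BV T u -> BV T y ->
  exists t, [/\ 0 < t, t < T, Cont T u t & Cont T y t].
Proof.
move=> uBV yBV; apply: contrapT => no.
have : countable (`]0, T[%classic : set R).
  apply: (@sub_countable _ _ _ (Discont T u `|` Discont T y)).
    apply: subset_card_le => t /= t0T; apply: contrapT => /not_orP[nu ny].
    have tT : `[0, T]%classic t by apply: subset_itv_oo_cc t0T.
    have cont (f : R -> H) : ~ Discont T f t -> Cont T f t.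
      by move=> nD; apply: contrapT => nC; apply: nD.
    by apply: no; exists t; split; rewrite ?(itvP t0T)//; exact: cont.
  rewrite -bigcup2E; apply: bigcup_countable => // -[|[|n]] _ //=;
    exact: countable_Discont.
move=> /countable_lebesgue_measure0; rewrite lebesgue_measure_itv/= lte_fin T0.
by rewrite sube0 => -[] /eqP; rewrite gt_eqF.
Qed.

(** The value of [y] at a single point where [u] and [y] are continuous is
    invisible to the differential measure, to the one-sided limits and to the
    jump conditions, so it can be chosen freely in [u t - Z]. *)
Lemma play_solution_update u z0 y t p : play_solution ip Z T u z0 y ->
  0 < t -> t < T -> Cont T u t -> Cont T y t -> Z p ->
  play_solution ip Z T u z0 (update y t (u t - p)).
Proof.
move=> [yBV [yZ yint yjump yjump' y0]] t0 tT ut yt Zp.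
have tne0 : t != 0 by rewrite gt_eqF.
have tneT : t != T by rewrite lt_eqF.
have Dne s : Discont T u s -> s == t = false.
  by move=> [_ nus]; apply: contra_notF nus => /eqP ->.
split; first exact: BV_update.
split.
- move=> s sT; rewrite /update; case: eqP => [->|_]; last exact: yZ.
  by rewrite opprB addrC subrK.
- move=> z zinf zZ; rewrite differential_measure_update//.
  have [muD mu1] := differential_measureP y T0.
  have mut : differential_measure T y [set t] = 0.
    have [->|//] := mu1 _ yt.1.
    by rewrite (limp_Cont yt) (limm_Cont yt) subrr.
  apply: (@vintegral_on_le0_cocountable _ _ _ hip `[0, T] _ (Cont T u `\ t)) => //.
  + by move=> s [].
  + by rewrite setDD; apply: sub_countable (@countable1 _ t); apply: subset_card_le => s [].
  + by move=> s; rewrite setDD => -[_ ->]; rewrite mut linear0r.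
  (* at [t] the new test function makes the integrand vanish *)
  have z'inf := Linfty_update t (u t - y t) mT zinf.
  have -> : vintegral_on ip `[0, T] (differential_measure T y) (Cont T u `\ t)
      (fun s => z s - u s + update y t (u t - p) s) =
    vintegral_on ip `[0, T] (differential_measure T y) (Cont T u)
      (fun s => update z t (u t - y t) s - u s + y s).
    congr (vintegral _ _ _ _); apply/funext => s; rewrite /update.
    case: eqP => [->|st].
      rewrite [in LHS]indicE memNset ?scale0r; last by case=> _; exact.
      by rewrite (addrAC (u t)) subrr sub0r addNr scaler0.
    congr (_ *: _); rewrite !indicE; congr (_%:R).
    congr nat_of_bool; apply/idP/idP => /set_mem Cs; apply/mem_set.
      by case: Cs.
    by split.
  apply: yint => // _ [s sT <-]; rewrite /update; case: eqP => _.
    exact/yZ/yt.1.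
  by apply: zZ; exists s.
- move=> s sT Ds s0; rewrite limm_update// {1}/update (Dne _ Ds).
  exact: yjump.
- move=> s Ds; rewrite limp_update// /update (Dne _ Ds).
  exact: yjump'.
- by rewrite /update eq_sym (negbTE tne0).
Qed.

(** By uniqueness the value of [y] at a common continuity point [c] is [u c - p]
    for every [p] in [Z], so [Z] has only the point [0]. *)
Lemma play_unique_eq u z0 y : Z 0 -> BV T u -> play_solution ip Z T u z0 y ->
  (forall y', play_solution ip Z T u z0 y' -> forall t, t \in `[0, T] -> y' t = y t) ->
  forall t, t \in `[0, T] -> y t = u t.
Proof.
move=> Z0 uBV ysol uniq t tT; have [yBV [yZ _ _ _ _]] := ysol.
have [c [c0 cT uc yc]] := common_continuity_point uBV yBV.
have Zval p : Z p -> y c = u c - p.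
  move=> Zp; have := uniq _ (play_solution_update ysol c0 cT uc yc Zp) c uc.1.
  by rewrite /update eqxx => <-.
have := Zval _ (yZ _ tT); rewrite (Zval _ Z0) subr0.
by move/eqP; rewrite eq_sym subr_eq addrC -subr_eq subrr eq_sym subr_eq0 => /eqP.
Qed.

Lemma eq_Cont u y : (forall t, t \in `[0, T] -> y t = u t) -> Cont T u `<=` Cont T y.
Proof.
move=> yu t [tT ut]; split => //; rewrite yu//.
apply: cvg_trans ut; apply: near_eq_cvg.
by rewrite near_withinE; near=> s => sT; rewrite yu.
Unshelve. all: by end_near. Qed.

End play.

(* "y is the unique solution": y solves (1)-(5), and either no other function
   on [0, T] does, or y is continuous wherever u is.  The second alternative
   only enlarges the class of y covered by the theorem. *)
Theorem theorem3p3 (R : realType) (H : completeNormedModType R)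
    (ip : {dot H for idfun})
    (hip : forall x : H, `|x| ^+ 2 = ip x x)
    (Z : set H) (Zclosed : closed Z) (Zconvex : convex_set Z) (Z0 : Z 0)
    (T : R) (T0 : 0 < T)
    (u : R -> H) (uBV : BV T u) (urc : rcontinuous T u)
    (z0 : H) (z0Z : Z z0)
    (y : R -> H) (ysol : play_solution ip Z T u z0 y)
    (yuniq :
      (forall y' : R -> H, play_solution ip Z T u z0 y' ->
         forall t : R, t \in `[0, T] -> y' t = y t) \/
      Cont T u `<=` Cont T y) :
  rcontinuous T y /\
  [/\ forall t : R, t \in `[0, T] -> Z (u t - y t),
      forall z : R -> H, Linfty `[0, T] z -> z @` `[0, T] `<=` Z ->
        vintegral_on ip `[0, T] (differential_measure T y) `[0, T]
          (fun t => z t - u t + y t) <= 0 &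
      u 0 - y 0 = z0].
Proof.
have [yBV [yZ yint yjump yjump' y0]] := ysol.
have yuC : Cont T u `<=` Cont T y.
  by case: yuniq => // uniq; exact/eq_Cont/(play_unique_eq hip T0 Z0 uBV ysol uniq).
have mT : measurable (`[0, T]%classic : set R) by exact: measurable_itv.
have yrc : rcontinuous T y.
  move=> t tT; have [/yuC/limp_Cont//|nut] := pselect (Cont T u t).
  have /yjump' : Discont T u t by split.
  by rewrite urc// Proj_id; [move/addrI/oppr_inj | exact: yZ].
split => //; split => // z zinf zZ.
have [muD mu1] := differential_measureP y T0.
apply: (vintegral_on_le0_cocountable hip mT muD _ _ _ _ (yint z zinf zZ)) => //.
- by move=> t [].
- exact: countable_Discont.
move=> t [tT nut]; have Zz : Z (z t) by apply: zZ; exists t.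
have [->|->] := mu1 t tT; last by rewrite linear0r.
rewrite yrc//; have [->|t0] := eqVneq t 0.
  by rewrite /limm eqxx subrr linear0r.
have ut : u t - y t = Proj Z (u t - limm y t) by apply: yjump.
have := Proj_obtuse hip (u t - limm y t) Zclosed Zconvex Zz.
rewrite -ut ipC.
have -> : u t - limm y t - (u t - y t) = y t - limm y t.
  by rewrite opprB addrC addrA subrK.
by have -> : z t - (u t - y t) = z t - u t + y t by rewrite opprB addrA addrAC.
Qed.
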